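(* Let $(X,d)$ be a geodesic space and let $\Phi:X\to\mathbb R\cup\{+\infty\}$ be a proper geodesically convex functional bounded from below. Let $p,q\in(1,+\infty)$ satisfy $p^{-1}+q^{-1}=1$. Suppose that $\Phi$ has at least one minimizer. If there exists $\kappa>0$ such that $$\operatorname{dist}\Big(u,\operatorname*{arg\,min}_{v\in X}\Phi(v)\Big)\le \kappa\,|\partial\Phi|(u)^{q/p}\qquad\forall u\in X,$$ then, for any $t>0$, $$\Phi(u)\ge \inf_{v\in X}\Phi(v)+\frac{t^{q/p}}{(t^{q/p}+\kappa)^p}\,\operatorname{dist}\Big(u,\operatorname*{arg\,min}_{v\in X}\Phi(v)\Big)^p\qquad\forall u\in\operatorname{dom}\operatorname{prox}_{t\Phi}.$$
   Context: A geodesic space is a metric space $(X,d)$ such that for every $u,v\in X$ there is a constant-speed geodesic $\gamma:[0,1]\to X$ with $\gamma(0)=u$ and $\gamma(1)=v$, where constant-speed geodesic means $d(\gamma(s),\gamma(t))=|s-t|\,d(\gamma(0),\gamma(1))$ for all $s,t\in[0,1]$. Completeness is not assumed. A functional $\Phi:X\to\mathbb R\cup\{+\infty\}$ is proper if it is not identically $+\infty$. It is geodesically convex if for every $u,v\in X$ there is at least one constant-speed geodesic $\gamma:[0,1]\to X$ with $\gamma(0)=u$, $\gamma(1)=v$ and $\Phi(\gamma(t))\le(1-t)\Phi(\gamma(0))+t\Phi(\gamma(1))$ for all $t\in[0,1]$. Lower semicontinuity is not assumed. For a functional $\Psi:X\to\mathbb R\cup\{+\infty\}$, the (set-valued, possibly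 empty) proximal mapping with exponent $p$ is $$\operatorname{prox}_{\Psi}(u):=\operatorname*{arg\,min}_{v\in X}\Big\{\Psi(v)+\frac1p\,d(v,u)^p\Big\},$$ and $\operatorname{dom}\operatorname{prox}_{\Psi}:=\{u\in X:\operatorname{prox}_{\Psi}(u)\ne\emptyset\}$. The metric slope of $\Phi$ at $u$ with $\Phi(u)<+\infty$ is $$|\partial\Phi|(u):=\max\Big\{\limsup_{v\to u}\frac{\Phi(u)-\Phi(v)}{d(u,v)},\,0\Big\}\in[0,+\infty],$$ where the limsup is over $v\ne u$; by convention $|\partial\Phi|(u)=+\infty$ if $\Phi(u)=+\infty$. Also $\operatorname{dist}(u,C):=\inf_{c\in C}d(u,c)$. *)

(* Defs.v *)
From HB Require Import structures.
From mathcomp Require Import all_boot all_order all_algebra.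
From mathcomp Require Import all_classical all_reals all_analysis.

Set Implicit Arguments.
Unset Strict Implicit.
Unset Printing Implicit Defensive.

Import Order.TTheory GRing.Theory Num.Theory.
Import numFieldNormedType.Exports.

Local Open Scope classical_set_scope.
Local Open Scope ring_scope.
Local Open Scope ereal_scope.

(* A curve [0,1] -> X is encoded by a function R -> X of which only the values
   on [0,1] are constrained or used. *)
Definition const_speed_geodesic (R : realType) (X : metricType R)
    (gamma : R -> X) : Prop :=
  forall s t : R, (0 <= s <= 1)%R -> (0 <= t <= 1)%R ->
    mdist (gamma s) (gamma t) = (`|s - t| * mdist (gamma 0%R) (gamma 1%R))%R.

Definition geodesic_space (R : realType) (X : metricType R) : Prop :=
  forall u v : X, exists gamma : R -> X,
    [/\ const_speed_geodesic gamma, gamma 0%R = u & gamma 1%R = v].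

Definition proper_functional (R : realType) (X : Type) (Phi : X -> \bar R) :
    Prop :=
  exists u : X, Phi u != +oo.

Definition bounded_from_below (R : realType) (X : Type) (Phi : X -> \bar R) :
    Prop :=
  exists m : R, forall u : X, m%:E <= Phi u.

(* Since 0 * +oo = 0, the inequality is the trivial one at t = 0 and t = 1 when
   an endpoint value is +oo. *)
Definition geodesically_convex (R : realType) (X : metricType R)
    (Phi : X -> \bar R) : Prop :=
  forall u v : X, exists gamma : R -> X,
    [/\ const_speed_geodesic gamma, gamma 0%R = u, gamma 1%R = v &
      forall t : R, (0 <= t <= 1)%R ->
        Phi (gamma t) <= (1 - t)%:E * Phi (gamma 0%R) + t%:E * Phi (gamma 1%R)].

Definition argmin (R : realType) (X : Type) (F : X -> \bar R) : set X :=
  [set v | forall w : X, F v <= F w].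

Definition prox (R : realType) (X : metricType R) (p : R) (Psi : X -> \bar R)
    (u : X) : set X :=
  argmin (fun v : X => Psi v + (p^-1 * mdist v u `^ p)%:E).

Definition dom_prox (R : realType) (X : metricType R) (p : R)
    (Psi : X -> \bar R) : set X :=
  [set u | prox p Psi u !=set0].

(* At a point u isolated in X the limsup over the improper filter u^' is -oo,
   so the slope there is 0. *)
Definition metric_slope (R : realType) (X : metricType R) (Phi : X -> \bar R)
    (u : X) : \bar R :=
  if Phi u == +oo then +oo
  else maxe (limf_esup (fun v : X => (Phi u - Phi v) / (mdist u v)%:E) u^') 0.

Definition set_dist (R : realType) (X : metricType R) (u : X) (C : set X) :
    \bar R :=
  ereal_inf [set (mdist u c)%:E | c in C].

(* Main.v *)
(** Let [v] be a proximal point of [u], [d := d(v,u)] and [T := t^(q/p)], so that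
    [T^(p-1) = t]. Minimality of [v] bounds the slope at [v] by [d^(p-1) / t],
    and the error bound at [v] becomes [dist(v, argmin) <= kappa d / T]; hence
    [dist(u, argmin) <= (T + kappa) d / T]. Minimality of [v] along a convexity
    geodesic from [v] to [u] gives [d^p <= t (Phi u - Phi v)]. Combine the two
    with [Phi v >= inf Phi]. *)

Require Import Defs.
From HB Require Import structures.
From mathcomp Require Import all_boot all_order all_algebra.
From mathcomp Require Import all_classical all_reals all_analysis.
From mathcomp Require Import ring lra.

Set Implicit Arguments.
Unset Strict Implicit.
Unset Printing Implicit Defensive.

Import Order.TTheory GRing.Theory Num.Theory.
Import numFieldNormedType.Exports.

Local Open Scope classical_set_scope.
Local Open Scope ring_scope.
Local Open Scope ereal_scope.

Lemma invr_powR (R : realType) (x r : R) :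
  (0 <= x -> x^-1 `^ r = (x `^ r)^-1)%R.
Proof. by move=> x0; rewrite -powR_inv1// -powRrM mulN1r powRN. Qed.

(** The graph of [x ^ p] lies above its tangent at [y]: this is [p] times Young's inequality for [x]
    and [y ^ (p - 1)], with exponents [p] and [p / (p - 1)]. *)
Lemma powR_tangent_le (R : realType) (p x y : R) :
  (1 < p -> 0 <= x -> 0 <= y ->
   y `^ p + p * y `^ (p - 1) * (x - y) <= x `^ p)%R.
Proof.
move=> p1 x0 y0; have p0 : (0 < p)%R by lra.
have pB0 : (0 < p - 1)%R by lra.
have young : (x * y `^ (p - 1) <=
    x `^ p / p + y `^ (p - 1) `^ (p / (p - 1)) / (p / (p - 1)))%R.
  apply: conjugate_powR => //; first exact: powR_ge0.
    by rewrite divr_gt0.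
  by field; rewrite !gt_eqF.
rewrite -powRrM in young.
have pE : ((p - 1) * (p / (p - 1)) = p)%R by field; rewrite gt_eqF.
rewrite pE in young.
have yE : (y * y `^ (p - 1) = y `^ p)%R by exact: mulr_powRB1.
have := ler_wpM2l (ltW p0) young.
have -> : (p * (x `^ p / p + y `^ p / (p / (p - 1))) =
           x `^ p + (p - 1) * y `^ p)%R.
  by field; rewrite !gt_eqF.
move=> H; have -> : (y `^ p + p * y `^ (p - 1) * (x - y) =
   y `^ p + p * (x * y `^ (p - 1)) - p * (y * y `^ (p - 1)))%R by ring.
rewrite yE; lra.
Qed.

(** By monotonicity, [d + h] may be taken to be the [r]-th root of [d ^ r + e]. This one-sided form
    is all that the slope estimate uses. *)
Lemma powR_right_continuous (R : realType) (r d e : R) :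
  (0 < r -> 0 <= d -> 0 < e -> exists2 h : R, 0 < h &
     forall x, 0 <= x <= d + h -> x `^ r <= d `^ r + e)%R.
Proof.
move=> r0 d0 e0; pose y := ((d `^ r + e) `^ r^-1)%R.
have yr : (y `^ r = d `^ r + e)%R.
  by rewrite -powRrM mulVf ?gt_eqF// powRr1// addr_ge0 ?powR_ge0// ltW.
have dy : (d < y)%R.
  rewrite ltNge; apply/negP => yd.
  have : (y `^ r <= d `^ r)%R.
    by apply: ge0_ler_powR; rewrite ?nnegrE ?powR_ge0// ltW.
  by rewrite yr; lra.
exists (y - d)%R; first by rewrite subr_gt0.
move=> x /andP[x0 xy]; rewrite -yr.
apply: ge0_ler_powR; rewrite ?nnegrE ?powR_ge0// ?(ltW r0)//; lra.
Qed.

Lemma set_dist_triangle (R : realType) (X : metricType R) (u v : X)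
    (C : set X) : set_dist u C <= (mdist u v)%:E + set_dist v C.
Proof.
rewrite -leeBlDl//; apply: le_ereal_inf_tmp => _ [c Cc <-].
rewrite leeBlDl// (@le_trans _ _ (mdist u c)%:E)//.
  by apply: ereal_inf_lbound; exists c.
by rewrite -EFinD lee_fin metric_triangle.
Qed.

Lemma set_dist_fin_num (R : realType) (X : metricType R) (u : X) (C : set X) :
  C !=set0 -> set_dist u C \is a fin_num.
Proof.
move=> [c Cc]; rewrite ge0_fin_numE.
  rewrite (@le_lt_trans _ _ (mdist u c)%:E) ?ltry//.
  by apply: ereal_inf_lbound; exists c.
by apply: le_ereal_inf_tmp => _ [x _ <-]; rewrite lee_fin mdist_ge0.
Qed.

(** Properness supplies a point [w] where the proximal objective is finite, while [Phi v = +oo]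
    would make its minimum [+oo]. *)
Lemma prox_fin_num (R : realType) (X : metricType R) (Phi : X -> \bar R)
    (p t : R) (u v : X) :
  (forall w, Phi w != -oo) -> proper_functional Phi -> (0 < t)%R ->
  prox p (fun w => t%:E * Phi w) u v -> Phi v \is a fin_num.
Proof.
move=> PhiNy [w Phiw] t0 /(_ w) /=.
rewrite fin_numE PhiNy/=; apply: contraTneq => ->.
rewrite gt0_muley ?lte_fin// addye//.
move: Phiw (PhiNy w); case: (Phi w) => [r _ _|//|//].
by rewrite -EFinM -EFinD leye_eq.
Qed.

(** Minimality against [w] gives [t (Phi v - Phi w) <= (d(w,u)^p - d(v,u)^p) / p]. The tangent at
    [d(w,u)] and the triangle inequality bound the right side by [d(w,u)^(p-1) d(v,w)], and the
    first factor is at most nearly [d(v,u)^(p-1)] for [w] close to [v]. *)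
Lemma metric_slope_prox_le (R : realType) (X : metricType R)
    (Phi : X -> \bar R) (p t : R) (u v : X) :
  (forall w, Phi w != -oo) -> (1 < p)%R -> (0 < t)%R ->
  Phi v \is a fin_num -> prox p (fun w => t%:E * Phi w) u v ->
  metric_slope Phi v <= (mdist v u `^ (p - 1) / t)%:E.
Proof.
move=> PhiNy p1 t0 /fineK Phiv vmin.
have p0 : (0 < p)%R by lra.
rewrite /metric_slope -{1}Phiv /= ge_max lee_fin divr_ge0 ?powR_ge0 ?(ltW t0)//.
rewrite andbT; apply/lee_addgt0Pr => e e0.
(* The tolerance [e * t] becomes [e] after the division by [t]; [h] is the radius of the punctured
   ball on which the supremum is estimated. *)
have [|||h h0 powh] :=
  @powR_right_continuous R (p - 1) (mdist v u) (e * t)%R.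
- lra.
- exact: mdist_ge0.
- exact: mulr_gt0.
apply: (@le_trans _ _ (ereal_sup ((fun w : X =>
    (Phi v - Phi w) / (mdist v w)%:E) @` (ball v h `\ v)))).
  apply: ereal_inf_lbound; exists (ball v h `\ v) => //.
  by apply: filterS (nbhsx_ballx v h h0) => w vw /eqP.
apply: ge_ereal_sup => _ [w [vw /eqP wv] <-].
move: vw; rewrite ballEmdist/= => vw.
have vw0 : (0 < mdist v w)%R by rewrite mdist_gt0 eq_sym.
rewrite inver gt_eqF//.
move: (PhiNy w) (vmin w) => /=; rewrite -Phiv.
(* Where [Phi w = +oo] the difference quotient is [-oo]. *)
case: (Phi w) => [b _|_ _|//]; last first.
  by rewrite addeNy mulNyr gtr0_sg ?invr_gt0// mul1e leNye.
rewrite -!EFinM -!EFinD !lee_fin => H.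
rewrite ler_pdivrMr//.
have wu0 : (0 <= mdist w u)%R by exact: mdist_ge0.
have vu0 : (0 <= mdist v u)%R by exact: mdist_ge0.
have wu : (mdist w u <= mdist v u + mdist v w)%R.
  by rewrite addrC (metric_sym v w) metric_triangle.
have tan := powR_tangent_le p1 vu0 wu0.
have Pw : (mdist w u `^ (p - 1) <= mdist v u `^ (p - 1) + e * t)%R.
  by apply: powh; lra.
set P := (mdist w u `^ (p - 1))%R in tan Pw.
have P0 : (0 <= P)%R by exact: powR_ge0.
have tf : (t * (fine (Phi v) - b) <= P * mdist v w)%R.
  apply: (@le_trans _ _ (P * (mdist w u - mdist v u))%R); last first.
    by apply: ler_wpM2l => //; lra.
  have := ler_wpM2l (ltW p0) H.
  rewrite !mulrDr !mulVKf ?gt_eqF// => H'.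
  rewrite -(ler_pM2l p0); lra.
rewrite -(ler_pM2l t0) (le_trans tf)//.
have -> : (t * ((mdist v u `^ (p - 1) / t + e) * mdist v w) =
   (mdist v u `^ (p - 1) + e * t) * mdist v w)%R.
  by field; rewrite gt_eqF.
by rewrite ler_wpM2r// ltW.
Qed.

(* Comparing the proximal point with points of a convexity geodesic close to it
   improves the factor 1/p of the plain comparison with [u] to 1. *)
Lemma prox_descent (R : realType) (X : metricType R)
    (Phi : X -> \bar R) (p t : R) (u v : X) :
  geodesically_convex Phi -> (1 < p)%R -> (0 < t)%R ->
  Phi u \is a fin_num -> Phi v \is a fin_num ->
  prox p (fun w => t%:E * Phi w) u v ->
  (mdist v u `^ p <= t * (fine (Phi u) - fine (Phi v)))%R.
Proof.
move=> convPhi p1 t0 /fineK Phiu /fineK Phiv vmin.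
have p0 : (0 < p)%R by lra.
have [gamma [geod g0 g1 conv]] := convPhi v u.
set d := mdist v u; have d0 : (0 <= d)%R by exact: mdist_ge0.
(* Proving the bound with every factor [c] in [(0,1)] on the left replaces the limit of geodesic
   points tending to [v]. *)
rewrite -lee_fin; apply/lee_mul01Pr; first by rewrite lee_fin powR_ge0.
move=> c /andP[c0 c1]; rewrite -EFinM lee_fin.
(* With [y ^ (p - 1) = c], the tangent at [y] reads [p c (1 - y) <= 1 - y ^ p]. The competitor is
   [gamma (1 - y)], at distance [y * d] from [u]. *)
pose y := (c `^ (p - 1)^-1)%R.
have y0 : (0 < y)%R by exact: powR_gt0.
have yc : (y `^ (p - 1) = c)%R.
  by rewrite -powRrM mulVf ?powRr1// ?(ltW c0)// gt_eqF// subr_gt0.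
have y1 : (y < 1)%R.
  rewrite ltNge; apply/negP => y1.
  have : (1 `^ (p - 1) <= y `^ (p - 1))%R.
    apply: ge0_ler_powR; rewrite ?nnegrE//; lra.
  by rewrite yc powR1; lra.
have s01 : (0 <= 1 - y <= 1)%R by lra.
have := conv _ s01; rewrite g0 g1 => Phig.
have distg : (mdist (gamma (1 - y)) u = y * d)%R.
  have := geod _ _ s01 (_ : 0 <= 1 <= 1)%R.
  rewrite g0 g1 => ->; last by rewrite ler01 lexx.
  by rewrite addrAC subrr sub0r normrN gtr0_norm.
have : t%:E * Phi v + (p^-1 * d `^ p)%:E <=
    t%:E * ((1 - (1 - y))%:E * Phi v + (1 - y)%:E * Phi u)
    + (p^-1 * (y * d) `^ p)%:E.
  apply: (le_trans (vmin (gamma (1 - y)%R))); rewrite /= distg leeD2r//.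
  by rewrite lee_pmul2l.
rewrite -Phiu -Phiv -!EFinM -!EFinD lee_fin /=.
rewrite powRM ?(ltW y0)// => H.
have tan := powR_tangent_le p1 ler01 (ltW y0).
rewrite powR1 yc in tan.
have dp0 : (0 <= d `^ p)%R by exact: powR_ge0.
have tan' := ler_wpM2r dp0 tan.
have := ler_wpM2l (ltW p0) H.
rewrite !mulrDr !mulVKf ?gt_eqF// => H'.
(* Both the energy gap and the tangent bound carry the factor [1 - y], which cancels. *)
have s0 : (0 < p * (1 - y))%R by rewrite mulr_gt0//; lra.
rewrite -(ler_pM2l s0); lra.
Qed.

Lemma ereal_inf_range_argmin (R : realType) (X : Type) (F : X -> \bar R)
    (c : X) : argmin F c -> ereal_inf (range F) = F c.
Proof.
move=> cmin; apply/eqP; rewrite eq_le; apply/andP; split.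
  by apply: ereal_inf_lbound; exists c.
by apply: le_ereal_inf_tmp => _ [x _ <-]; exact: cmin.
Qed.

Theorem proposition1p11 (R : realType) (X : metricType R) (Phi : X -> \bar R)
    (p q kappa : R) :
  geodesic_space X ->
  (forall u : X, Phi u != -oo) ->
  proper_functional Phi ->
  geodesically_convex Phi ->
  bounded_from_below Phi ->
  (1 < p)%R -> (1 < q)%R -> (p^-1 + q^-1 = 1)%R ->
  argmin Phi !=set0 ->
  (0 < kappa)%R ->
  (forall u : X,
    set_dist u (argmin Phi) <= kappa%:E * metric_slope Phi u `^ (q / p)%R) ->
  forall t : R, (0 < t)%R ->
  forall u : X, dom_prox p (fun v : X => t%:E * Phi v) u ->
    ereal_inf (range Phi)
      + (t `^ (q / p) / (t `^ (q / p) + kappa) `^ p)%:E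
        * set_dist u (argmin Phi) `^ p
    <= Phi u.
Proof.
move=> _ PhiNy proper convPhi _ p1 q1 pq Cne k0 slope t t0 u [v vprox].
have p0 : (0 < p)%R by lra.
have [->|Phiuy] := eqVneq (Phi u) +oo; first exact: leey.
have Phiu : Phi u \is a fin_num by rewrite fin_numE PhiNy.
have Phiv := prox_fin_num PhiNy proper t0 vprox.
have [c cmin] := Cne.
rewrite (ereal_inf_range_argmin cmin).
have Phic : Phi c \is a fin_num.
  by rewrite fin_numE PhiNy/= -ltey (le_lt_trans (cmin u))// ltey.
have slopev := metric_slope_prox_le PhiNy p1 t0 Phiv vprox.
have slope0 : 0 <= metric_slope Phi v.
  by rewrite /metric_slope; case: ifP => // _; rewrite le_max lexx orbT.
have := prox_descent convPhi p1 t0 Phiu Phiv vprox.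
set d := mdist v u in slopev * => descent.
have d0 : (0 <= d)%R by exact: mdist_ge0.
(* Conjugacy makes [q / p] the inverse of [p - 1], so raising the slope bound [d ^ (p - 1) / t] to
   this power makes it linear in [d]. *)
have qpE : ((p - 1) * (q / p) = 1)%R.
  have qE : (q = p / (p - 1))%R.
    have q0 : q != 0%R by rewrite gt_eqF//; lra.
    apply: (mulIf (_ : p - 1 != 0)%R); first by rewrite gt_eqF// subr_gt0.
    rewrite divfK ?gt_eqF ?subr_gt0//.
    have : (p * q * (p^-1 + q^-1) = p * q)%R by rewrite pq mulr1.
    have -> : (p * q * (p^-1 + q^-1) = q + p)%R.
      by field; rewrite q0 gt_eqF.
    lra.
  by rewrite qE; field; rewrite !gt_eqF//; lra.
have qp0 : (0 <= q / p)%R by rewrite divr_ge0; lra.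
set r := (q / p)%R in qpE qp0 slope *; set T := (t `^ r)%R.
have T0 : (0 < T)%R by exact: powR_gt0.
have distv : set_dist v (argmin Phi) <= (kappa * (d / T))%:E.
  apply: (le_trans (slope v)); rewrite EFinM lee_pmul2l//.
  have -> : (d / T = (d `^ (p - 1) / t) `^ r)%R.
    rewrite powRM ?powR_ge0 ?invr_ge0 ?(ltW t0)//.
    by rewrite -powRrM qpE powRr1// invr_powR ?ltW.
  rewrite -poweR_EFin gt0_ler_poweR// in_itv/= leey ?slope0//.
  by rewrite andbT lee_fin divr_ge0 ?powR_ge0 ?(ltW t0).
have := set_dist_triangle u v (argmin Phi).
have : 0 <= set_dist u (argmin Phi).
  by apply: le_ereal_inf_tmp => _ [x _ <-]; rewrite lee_fin mdist_ge0.
have := set_dist_fin_num u Cne => /fineK <-.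
set D := fine _; rewrite lee_fin => D0 Dle.
have {Dle} : (D <= d + kappa * (d / T))%R.
  by rewrite -lee_fin EFinD (le_trans Dle)// metric_sym leeD2l.
have -> : (d + kappa * (d / T) = (T + kappa) * (d / T))%R.
  by field; rewrite gt_eqF.
have Tk0 : (0 < T + kappa)%R by lra.
rewrite -ler_pdivrMl// => Dd.
have Tp : (T `^ p = t * T)%R.
  have -> : (p = (p - 1) + 1)%R by ring.
  rewrite powRD; last by apply/implyP => _; rewrite gt_eqF.
  rewrite powRr1 ?(ltW T0)// /T -powRrM mulrC (mulrC r) qpE.
  by rewrite powRr1 ?(ltW t0)// mulrC.
(* Since [T ^ p = t * T], the [p]-th power of [D / (T + kappa) <= d / T] has right side
   [d ^ p / (t * T)]; the descent estimate absorbs [d ^ p / t] and leaves [T] in the numerator of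
   the constant. *)
have bound : (T / (T + kappa) `^ p * D `^ p <= fine (Phi u) - fine (Phi v))%R.
  have : (((T + kappa)^-1 * D) `^ p <= (d / T) `^ p)%R.
    apply: ge0_ler_powR => //; rewrite ?nnegrE; first exact: ltW.
    + by rewrite mulr_ge0// invr_ge0 ltW.
    + by rewrite divr_ge0// ltW.
  rewrite !powRM ?invr_ge0 ?(ltW Tk0) ?(ltW T0)// !invr_powR ?(ltW T0) ?(ltW Tk0)// Tp => H.
  rewrite -(ler_pM2l t0) (le_trans _ descent)//.
  have tT : (0 < t * T)%R by exact: mulr_gt0.
  rewrite (ler_pdivlMr _ _ tT) in H; apply: le_trans H.
  by rewrite le_eqVlt; apply/orP; left; apply/eqP; ring.
have cv : (fine (Phi c) <= fine (Phi v))%R by rewrite fine_le// cmin.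
rewrite poweR_EFin -(fineK Phic) -(fineK Phiu) -EFinM -EFinD lee_fin.
by lra.
Qed.
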